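(* Let $Q$ be a finite quiver, let $\alpha\in\mathbb{Z}_{\ge0}^{Q_0}$ be a dimension vector, and let $W$ be a finite-dimensional representation of $Q$ over a field $\mathbb{F}$. Then $$\operatorname{ncext}(\alpha,W)=\max\{-\langle\alpha,\underline{\dim}\,W''\rangle\mid W''\text{ a factor representation of }W\}.$$
   Context: $\operatorname{Rep}_\alpha(Q)$ is the space of representations of $Q$ with dimension vector $\alpha$. The Euler form is $\langle\alpha,\beta\rangle=\sum_{x\in Q_0}\alpha(x)\beta(x)-\sum_{a\in Q_1}\alpha(ta)\beta(ha)$, where $ta,ha$ are the tail and head of the arrow $a$; $\dim\operatorname{Hom}_Q(V,W)-\dim\operatorname{Ext}_Q(V,W)=\langle\underline{\dim}\,V,\underline{\dim}\,W\rangle$, where $\operatorname{Ext}_Q=\operatorname{Ext}^1_Q$. General hom and ext: let $t$ be the minimal value of $\dim\operatorname{Hom}_Q(V,W)$ over $V\in\operatorname{Rep}_\alpha(Q)$. A representation $V\in\operatorname{Rep}_\alpha(Q)$ is $(\alpha,W)$-general if $\dim\operatorname{Hom}_Q(V,W)=t$. For such $V$, $\hom(\alpha,W)=\dim\operatorname{Hom}_Q(V,W)$ and $\operatorname{ext}(\alpha,W)=\dim\operatorname{Ext}_Q(V,W)$. Non-commutative ext: $\operatorname{ncext}(\alpha,W)=\lim_{d\to\infty}\operatorname{ext}(d\alpha,W)/d$. A factor representation of $W$ is a quotient $W/W'$ by a subrepresentation $W'$ (including $0$ and $W$). *)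

(* Defs.v *)
From HB Require Import structures.
From mathcomp Require Import all_boot all_order all_algebra.
From mathcomp Require Import boolp classical_sets reals topology normedtype.
From mathcomp Require Import sequences.

Set Implicit Arguments.
Unset Strict Implicit.
Unset Printing Implicit Defensive.

Import Order.TTheory GRing.Theory Num.Theory.
Import numFieldNormedType.Exports.

Local Open Scope ring_scope.

(* MathComp gives {ffun I -> V} a vector space structure, but not dependent
   products; the direct sums over vertices and over arrows below need them. *)
Section DirectSum.

Variables (I : finType) (F : fieldType) (U : I -> vectType F).

Local Notation dsum := {dffun forall i : I, U i}.

Implicit Types (f g : dsum) (c : F).

Definition dsum_zero : dsum := [ffun i => 0 : U i].
Definition dsum_opp f : dsum := [ffun i => - f i].
Definition dsum_add f g : dsum := [ffun i => f i + g i].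
Definition dsum_scale c f : dsum := [ffun i => c *: f i].

Fact dsum_addA : associative dsum_add.
Proof. by move=> f g h; apply/ffunP => i; rewrite !ffunE addrA. Qed.
Fact dsum_addC : commutative dsum_add.
Proof. by move=> f g; apply/ffunP => i; rewrite !ffunE addrC. Qed.
Fact dsum_add0 : left_id dsum_zero dsum_add.
Proof. by move=> f; apply/ffunP => i; rewrite !ffunE add0r. Qed.
Fact dsum_addN : left_inverse dsum_zero dsum_opp dsum_add.
Proof. by move=> f; apply/ffunP => i; rewrite !ffunE addNr. Qed.

HB.instance Definition _ := GRing.isZmodule.Build dsum
  dsum_addA dsum_addC dsum_add0 dsum_addN.

Fact dsum_scaleA c1 c2 f :
  dsum_scale c1 (dsum_scale c2 f) = dsum_scale (c1 * c2) f.
Proof. by apply/ffunP => i; rewrite !ffunE scalerA. Qed.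
Fact dsum_scale1 : left_id 1 dsum_scale.
Proof. by move=> f; apply/ffunP => i; rewrite !ffunE scale1r. Qed.
Fact dsum_scaleDr : right_distributive dsum_scale +%R.
Proof. by move=> c f g; apply/ffunP => i; rewrite !ffunE scalerDr. Qed.
Fact dsum_scaleDl f : {morph dsum_scale^~ f : c1 c2 / c1 + c2}.
Proof. by move=> c1 c2; apply/ffunP => i; rewrite !ffunE scalerDl. Qed.

HB.instance Definition _ := GRing.Zmodule_isLmodule.Build F dsum
  dsum_scaleA dsum_scale1 dsum_scaleDr dsum_scaleDl.

Lemma dsumD f g i : (f + g) i = f i + g i.
Proof. by rewrite ffunE. Qed.

Lemma dsumN f i : (- f) i = - f i.
Proof. by rewrite ffunE. Qed.

Lemma dsum0 i : (0 : dsum) i = 0.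
Proof. by rewrite ffunE. Qed.

Lemma dsumZ c f i : (c *: f) i = c *: f i.
Proof. by rewrite ffunE. Qed.

Import VectorInternalTheory.

Let sdim (k : 'I_#|I|) : nat := dim (U (enum_val k)).

Fact dsum_vect_iso : Vector.axiom (\sum_k sdim k) dsum.
Proof.
pose fr f : 'rV[F]_(\sum_k sdim k) := \mxrow_k (v2r (f (enum_val k))).
pose get (A : 'rV[F]_(\sum_k sdim k)) k : U (enum_val k) :=
  @r2v F (U (enum_val k)) (submxrow A k).
pose fV (A : 'rV[F]_(\sum_k sdim k)) : dsum :=
  [ffun i => eq_rect _ (fun j => U j : Type) (get A (enum_rank i)) _
    (enum_rankK i)].
exists fr.
  move=> c f g; rewrite /fr; apply/mxrowP => k.
  by apply/rowP => j; rewrite !mxE ffunE ffunE linearD linearZ /= !mxE.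
exists fV => [f|A].
  apply/ffunP => i; rewrite ffunE /get /fr mxrowK v2rK.
  have E j (e : j = i) : eq_rect j (fun k => U k : Type) (f j) i e = f i.
    by case: _ / e.
  exact: E.
apply/mxrowP => k; rewrite /fr mxrowK ffunE.
have E l (e : enum_val l = enum_val k) : l = k ->
  v2r (eq_rect _ (fun j => U j : Type) (get A l) _ e) = submxrow A k.
  move=> lk; move: e; rewrite lk => e.
  by rewrite (eq_irrelevance e erefl) /= /get r2vK.
by apply: E; rewrite enum_valK.
Qed.

HB.instance Definition _ := Lmodule_hasFinDim.Build F dsum dsum_vect_iso.

Lemma dim_dsum : \dim {: dsum} = (\sum_i \dim {: U i})%N.
Proof.
rewrite dimvf /dim /= /sdim.
under [RHS]eq_bigr do rewrite dimvf.
by rewrite [RHS](reindex _ (onW_bij _ (enum_val_bij I))).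
Qed.

End DirectSum.

Record quiver := Quiver {
  vert : finType;
  arrow : finType;
  ta : arrow -> vert;
  ha : arrow -> vert }.

Arguments ta {q} a.
Arguments ha {q} a.

Definition dimvec (Q : quiver) := vert Q -> nat.

Definition scale_dimvec (Q : quiver) (d : nat) (alpha : dimvec Q) : dimvec Q :=
  fun x => (d * alpha x)%N.

Definition euler (Q : quiver) (alpha beta : dimvec Q) : int :=
  \sum_(x : vert Q) (alpha x * beta x)%N%:Z
  - \sum_(a : arrow Q) (alpha (ta a) * beta (ha a))%N%:Z.

Record rep (F : fieldType) (Q : quiver) := Rep {
  rep_space :> vert Q -> vectType F;
  rep_map : forall a : arrow Q, 'Hom(rep_space (ta a), rep_space (ha a)) }.

Arguments Rep {F Q}.
Arguments rep_map {F Q}.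

Definition rep_dimvec (F : fieldType) (Q : quiver) (W : rep F Q) : dimvec Q :=
  fun x => \dim {: W x}.

Definition Rep_alpha (F : fieldType) (Q : quiver) (alpha : dimvec Q) :=
  {dffun forall a : arrow Q, 'Hom('rV[F]_(alpha (ta a)), 'rV[F]_(alpha (ha a)))}.

Definition rep_of (F : fieldType) (Q : quiver) (alpha : dimvec Q)
    (V : Rep_alpha F alpha) : rep F Q :=
  Rep (fun x => 'rV[F]_(alpha x) : vectType F) (fun a => V a).

Section HomExt.

Variables (F : fieldType) (Q : quiver) (V W : rep F Q).

Definition vert_hom := {dffun forall x : vert Q, 'Hom(V x, W x)}.
Definition arrow_hom := {dffun forall a : arrow Q, 'Hom(V (ta a), W (ha a))}.
HB.instance Definition _ := Vector.on vert_hom.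
HB.instance Definition _ := Vector.on arrow_hom.

Definition is_morphism (phi : vert_hom) : Prop :=
  forall a, (phi (ha a) \o rep_map V a = rep_map W a \o phi (ta a))%VF.

Definition hom_diff_fun (phi : vert_hom) : arrow_hom :=
  [ffun a => (phi (ha a) \o rep_map V a)%VF - (rep_map W a \o phi (ta a))%VF].

Fact hom_diff_is_linear : linear hom_diff_fun.
Proof.
move=> c f g; apply/ffunP => a; rewrite !(dsumD, dsumZ, ffunE).
rewrite comp_lfunDl comp_lfunDr -comp_lfunZl -comp_lfunZr.
by rewrite opprD addrACA -scalerBr.
Qed.

HB.instance Definition _ :=
  GRing.isLinear.Build F vert_hom arrow_hom _ hom_diff_fun hom_diff_is_linear.

Definition hom_diff : 'Hom(vert_hom, arrow_hom) := linfun hom_diff_fun.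

Definition HomQ : {vspace vert_hom} := lker hom_diff.

Lemma mem_HomQ (phi : vert_hom) : phi \in HomQ <-> is_morphism phi.
Proof.
rewrite memv_ker lfunE /=; split => [/eqP/ffunP H a|H].
  by apply/eqP; rewrite -subr_eq0; apply/eqP; have := H a; rewrite !ffunE.
by apply/eqP/ffunP => a; rewrite !ffunE H subrr.
Qed.

Definition dimHom : nat := \dim HomQ.

(* Ext^1 is the cokernel of hom_diff: c in arrow_hom is the cocycle of the
   extension ext_rep c below of V by W, and by ext_equivP two cocycles give
   equivalent extensions iff they differ by an element of the image. *)
Definition dimExt : nat := (\dim {: arrow_hom} - \dim (limg hom_diff))%N.

Lemma dimHomBdimExt :
  dimHom%:Z - dimExt%:Z = euler (rep_dimvec V) (rep_dimvec W).
Proof.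
have rk : (dimHom + \dim (limg hom_diff))%N = \dim {: vert_hom}.
  by rewrite /dimHom -(limg_ker_dim hom_diff fullv) capfv.
have le : (\dim (limg hom_diff) <= \dim {: arrow_hom})%N.
  by apply: dimvS; apply: subvf.
have dh (aT rT : vectType F) :
  \dim {: 'Hom(aT, rT)} = (\dim {: aT} * \dim {: rT})%N.
  by rewrite !dimvf.
have e1 : \dim {: vert_hom} =
    (\sum_x rep_dimvec V x * rep_dimvec W x)%N.
  rewrite [LHS]dim_dsum; apply: eq_bigr => x _; exact: dh.
have e2 : \dim {: arrow_hom} =
    (\sum_(a : arrow Q) rep_dimvec V (ta a) * rep_dimvec W (ha a))%N.
  rewrite [LHS]dim_dsum; apply: eq_bigr => a _; exact: dh.
have sz (I : finType) (f : I -> nat) :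
  \sum_i (f i)%:Z = (\sum_i f i)%N%:Z.
  by rewrite (big_morph Posz PoszD (erefl _)).
by rewrite /euler !sz -e1 -e2 /dimExt -(subzn le) opprB addrA -rk PoszD.
Qed.

(* The extension 0 -> W -> ext_rep c -> V -> 0 with cocycle c. *)
Definition ext_map (c : arrow_hom) (a : arrow Q)
    (p : W (ta a) * V (ta a)) : W (ha a) * V (ha a) :=
  (rep_map W a p.1 + c a p.2, rep_map V a p.2).

Fact ext_map_is_linear (c : arrow_hom) (a : arrow Q) : linear (@ext_map c a).
Proof.
move=> k p q; rewrite /ext_map /= !linearP /=.
by congr pair; rewrite /= scalerDr addrACA.
Qed.

HB.instance Definition _ (c : arrow_hom) (a : arrow Q) :=
  GRing.isLinear.Build F (W (ta a) * V (ta a))%type (W (ha a) * V (ha a))%type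
    _ (@ext_map c a) (@ext_map_is_linear c a).

Definition ext_rep (c : arrow_hom) : rep F Q :=
  Rep (fun x => (W x * V x)%type : vectType F) (fun a => linfun (@ext_map c a)).

End HomExt.

Section ExtEquiv.

Variables (F : fieldType) (Q : quiver) (V W : rep F Q).

(* A morphism of extensions inducing the identity on W and on V. *)
Definition ext_equiv (c c' : arrow_hom V W) : Prop :=
  exists theta : vert_hom (ext_rep c) (ext_rep c'),
    [/\ is_morphism theta,
        forall x (w : W x), theta x (w, 0) = (w, 0) &
        forall x (p : W x * V x), (theta x p).2 = p.2].

Lemma ext_equivP (c c' : arrow_hom V W) :
  ext_equiv c c' <-> c - c' \in limg (hom_diff V W).
Proof.
split.
- move=> [theta [th_mor thW thV]].
  pose h0 x (v : V x) : W x := (theta x (0, v)).1.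
  have h0_lin x : linear (@h0 x).
    move=> k v v'; rewrite /h0.
    have -> : (0, k *: v + v') = k *: (0, v) + (0, v') :> (W x * V x)%type.
      by congr pair; rewrite /= scaler0 addr0.
    by rewrite linearP.
  pose hL x := GRing.isLinear.Build F (V x) (W x) _ (@h0 x) (@h0_lin x).
  pose h0' x : {linear V x -> W x} := HB.pack (@h0 x) (hL x).
  pose h : vert_hom V W := [ffun x => linfun (h0' x)].
  have thE x w v : theta x (w, v) = (w + h0 x v, v).
    have -> : (w, v) = (w, 0) + (0, v) :> (W x * V x)%type.
      by congr pair; rewrite /= ?addr0 ?add0r.
    rewrite linearD /= thW [theta x (0, v)]surjective_pairing thV /=.
    by congr pair; rewrite /= add0r.
  apply/memv_imgP; exists (- h); first exact: memvf.
  rewrite lfunE /=; apply/ffunP => a; apply/lfunP => v.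
  have := congr1 (fun f : 'Hom(_, _) => (f (0, v)).1) (th_mor a).
  rewrite !comp_lfunE /= !lfunE /= /ext_map /= thE /= !linear0 !add0r.
  rewrite thE /=.
  rewrite add0r => E.
  have hE x u : (- h) x u = - h0 x u by rewrite dsumN opp_lfunE ffunE lfunE.
  rewrite [hom_diff_fun _ _]ffunE !add_lfunE !opp_lfunE !comp_lfunE !hE.
  rewrite dsumD dsumN add_lfunE opp_lfunE linearN opprK.
  by apply/eqP; rewrite subr_eq -addrA -E addrC addrK.
- move=> /memv_imgP[h _ hE].
  pose t0 x (p : W x * V x) : W x * V x := (p.1 - h x p.2, p.2).
  have t0_lin x : linear (@t0 x).
    move=> k p q; rewrite /t0; congr pair; rewrite /=.
    by rewrite linearP opprD scalerBr addrACA.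
  pose tL x := GRing.isLinear.Build F (W x * V x)%type (W x * V x)%type _
    (@t0 x) (@t0_lin x).
  pose t0' x : {linear (W x * V x)%type -> (W x * V x)%type} :=
    HB.pack (@t0 x) (tL x).
  pose theta : vert_hom (ext_rep c) (ext_rep c') :=
    [ffun x => linfun (t0' x)].
  have thE x p : theta x p = t0 x p by rewrite ffunE lfunE.
  exists theta; split=> [a|x w|x p]; rewrite ?thE ?/t0 /= ?linear0 ?subr0 ?addr0 //.
  apply/lfunP => -[w v]; rewrite !comp_lfunE !thE /= !lfunE /= /ext_map /t0 /=.
  congr pair; have := congr1 (fun f : arrow_hom V W => f a v) hE.
  rewrite lfunE /= dsumD dsumN [hom_diff_fun _ _]ffunE !add_lfunE !opp_lfunE.
  rewrite !comp_lfunE => E.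
  have -> : c a v = h (ha a) (rep_map V a v) - rep_map W a (h (ta a) v) + c' a v.
    by rewrite -E subrK.
  rewrite linearB /= -!addrA; congr (_ + _).
  by rewrite addrC -!addrA addNr addr0.
Qed.

End ExtEquiv.

Section Factor.

Variables (F : fieldType) (Q : quiver) (W : rep F Q).

Definition subrep (U : forall x, {vspace W x}) : Prop :=
  forall a, (rep_map W a @: U (ta a) <= U (ha a))%VS.

(* W'' is the quotient of W by the subrepresentation U, up to isomorphism:
   pi is the projection. *)
Definition is_quotient (U : forall x, {vspace W x}) (W'' : rep F Q) : Prop :=
  exists2 pi : vert_hom W W'', is_morphism pi &
    forall x, limg (pi x) = fullv /\ lker (pi x) = U x.

Definition factor_rep (W'' : rep F Q) : Prop :=
  exists2 U : forall x, {vspace W x}, subrep U & is_quotient U W''.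

End Factor.

Section GeneralExt.

Variables (F : fieldType) (Q : quiver) (alpha : dimvec Q) (W : rep F Q).

Fact hom_gen_subproof :
  exists n, `[< exists V : Rep_alpha F alpha, dimHom (rep_of V) W = n >].
Proof.
by exists (dimHom (rep_of (0 : Rep_alpha F alpha)) W); apply/asboolP; exists 0.
Qed.

Definition hom_gen : nat := ex_minn hom_gen_subproof.

Definition general (V : Rep_alpha F alpha) : Prop :=
  dimHom (rep_of V) W = hom_gen.

Fact general_exists : exists V, general V.
Proof. by rewrite /general /hom_gen; case: ex_minnP => n /asboolP. Qed.

(* By ext_genE this does not depend on the chosen general V. *)
Definition ext_gen : nat := dimExt (rep_of (projT1 (cid general_exists))) W.

Lemma ext_genE (V : Rep_alpha F alpha) :
  general V -> dimExt (rep_of V) W = ext_gen.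
Proof.
rewrite /ext_gen; case: cid => V' /= gV' gV.
have dimE (V0 : Rep_alpha F alpha) : rep_dimvec (rep_of V0) =1 alpha.
  by move=> x; rewrite /rep_dimvec /= dimvf /dim /= mul1n.
have eE : euler (rep_dimvec (rep_of V)) (rep_dimvec W)
        = euler (rep_dimvec (rep_of V')) (rep_dimvec W).
  by rewrite /euler; congr (_ - _); apply: eq_bigr => i _; rewrite !dimE.
have hV := dimHomBdimExt (rep_of V) W; rewrite gV eE in hV.
have := dimHomBdimExt (rep_of V') W; rewrite gV' -hV.
by move=> /addrI/oppr_inj[].
Qed.

End GeneralExt.

Definition ncext_seq (R : realType) (F : fieldType) (Q : quiver)
    (alpha : dimvec Q) (W : rep F Q) : nat -> R :=
  fun d => (ext_gen (scale_dimvec d alpha) W)%:R / d%:R.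

(* limn returns a default value on divergent sequences, so statements about
   ncext should come with the convergence of ncext_seq. *)
Definition ncext (R : realType) (F : fieldType) (Q : quiver)
    (alpha : dimvec Q) (W : rep F Q) : R :=
  limn (ncext_seq R alpha W).

Definition is_max (R : realType) (A : set R) (m : R) : Prop :=
  A m /\ ubound A m.

(* Main.v *)
(* For V in Rep_{d alpha}, dim Ext(V,W) >= -d<alpha, dim W''> for every factor
   W'' of W because Ext(V,-) is right exact. Conversely, with U ranging over
   the subrepresentations of W and C = sum_x (dim W_x)^2, some V satisfies
   dim Hom(V,W) <= d max_U <alpha, dim U> + C, so that ext(d alpha,W)/d lies
   within C/d of the maximum.

   Over a finite field, such a V exists by counting the pairs (V, phi) with
   phi in Hom(V,W): for phi with image U the condition on V is affine of
   codimension sum_a d alpha(ta) dim U(ha), and the number of possible U is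
   bounded independently of d.

   Over an infinite field, take V general and phi in Hom(V,W) of maximal rank
   among all general V; let U be its image. Deforming V along V + tD lifts phi
   to a polynomial curve of morphisms of the same rank, whose derivative maps
   ker(phi) into U. Hence Hom(V,W) lies in T = {psi : psi(ker phi) <= U}, and
   every family V(ta) -> U(ha) is hit by T under the differential of Hom(V,W);
   dim T <= sum_x d alpha(x) dim U(x) + C gives the bound. *)
From HB Require Import structures.
Require Import Defs.
From mathcomp Require Import all_boot all_order all_algebra.
From mathcomp Require Import boolp classical_sets reals topology normedtype.
From mathcomp Require Import sequences.
From mathcomp Require Import finfield zify.

Set Implicit Arguments.
Unset Strict Implicit.
Unset Printing Implicit Defensive.

Import Order.TTheory GRing.Theory Num.Theory numFieldNormedType.Exports.

Local Open Scope ring_scope.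

Local Notation "M .<[ t ]>" := (map_mx (horner_eval t) M)
  (at level 2, format "M .<[ t ]>").
Local Notation lift := (map_mx polyC).

(** * Deformations of kernels *)

Section AlmostAll.
Variable F : fieldType.

(* Over a finite field every P satisfies this: take s = 'X^q - 'X. *)
Definition almost_all (P : F -> Prop) :=
  exists2 s : {poly F}, s != 0 & forall t, s.[t] != 0 -> P t.

Lemma almost_all_imp (P P' : F -> Prop) :
  (forall t, P t -> P' t) -> almost_all P -> almost_all P'.
Proof. by move=> PP' [s s0 Ps]; exists s => // t /Ps/PP'. Qed.

Lemma almost_all_and (P P' : F -> Prop) :
  almost_all P -> almost_all P' -> almost_all (fun t => P t /\ P' t).
Proof.
move=> [s s0 Ps] [s' s'0 Ps']; exists (s * s'); first by rewrite mulf_neq0.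
by move=> t; rewrite hornerM mulf_eq0 negb_or => /andP[/Ps ? /Ps' ?].
Qed.

Lemma almost_all_fin (I : finType) (P : I -> F -> Prop) :
  (forall i, almost_all (P i)) -> almost_all (fun t => forall i, P i t).
Proof.
move=> aP.
have: almost_all (fun t => forall i, i \in enum I -> P i t).
  elim: (enum I) => [|i e IHe]; first by exists 1; rewrite ?oner_neq0.
  apply: almost_all_imp (almost_all_and (aP i) IHe) => t [Pi Pe] j.
  by rewrite inE => /predU1P[->|/Pe].
by apply: almost_all_imp => t Pe i; apply: Pe; rewrite mem_enum.
Qed.

(** Phrased through polynomials, since it serves to check polynomial identities at the points of
    [F]. *)
Definition infinite_field := forall p : {poly F}, (forall t, p.[t] = 0) -> p = 0.

Lemma almost_all_poly_eq0 (p : {poly F}) :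
  infinite_field -> almost_all (fun t => p.[t] = 0) -> p = 0.
Proof.
move=> infF [s s0 ps]; have /eqP: s * p = 0; last by rewrite mulf_eq0 (negPf s0) => /eqP.
apply: infF => t; rewrite hornerM; have [->|/ps->] := eqVneq s.[t] 0.
  by rewrite mul0r.
by rewrite mulr0.
Qed.

(** A nonzero [p] has fewer than [size p] distinct roots; if no list exhausted [F], one could pick
    [size p] distinct elements, all of them roots. *)
Lemma infinite_fieldPn : ~ infinite_field -> exists e : seq F, forall t, t \in e.
Proof.
move=> /existsNP[p /not_implyP[p0 /eqP pn0]]; apply: contrapT => /forallNP noe.
have [s us ss]: exists2 s : seq F, uniq s & size s = size p.
  elim: (size p) => [|n [s us <-]]; first by exists [::].
  by have /existsNP[t /negP ts] := noe s; exists (t :: s); rewrite //= ts.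
have ps : all (root p) s by apply/allP => t _; apply/eqP/p0.
by have := max_poly_roots pn0 ps us; rewrite ss ltnn.
Qed.

Lemma evalC t m n (B : 'M[F]_(m, n)) : (lift B).<[t]> = B.
Proof. by apply/matrixP => i j; rewrite !mxE /horner_eval hornerC. Qed.

Lemma det_neq0 p (G : 'M[{poly F}]_p) t : G.<[t]> = 1%:M -> \det G != 0.
Proof.
move=> Gt; apply/eqP => /(congr1 (horner_eval t)); rewrite -det_map_mx Gt det1.
by move=> /eqP; rewrite rmorph0 oner_eq0.
Qed.

(* G = 1 + (M - M(0)) M(0)^+ with M(0)^+ a generalized inverse: multiplying
   v M(t) = 0 by M(0)^+ M(0) gives v G(t) M(0) = 0. *)
Lemma kernel_shift p q (M : 'M[{poly F}]_(p, q)) (D := M.<[0]>) :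
  exists G : 'M[{poly F}]_p, G.<[0]> = 1%:M /\
  forall t, (kermx M.<[t]> *m G.<[t]> <= kermx D)%MS.
Proof.
exists (1%:M + (M - lift D) *m lift (pinvmx D)).
split=> [|t]; rewrite map_mxD map_mx1 map_mxM map_mxB !evalC.
  by rewrite subrr mul0mx addr0.
apply/sub_kermxP; rewrite mulmxDr mulmx1 mulmxDl mulmxA mulmxBr mulmx_ker.
by rewrite sub0r -[- (_ *m D)]mulNmx mulmxKpV ?submxMl // mulNmx subrr.
Qed.

Lemma det_eval_unit p (G : 'M[{poly F}]_p) t :
  (\det G).[t] != 0 -> G.<[t]> \in unitmx.
Proof. by rewrite unitmxE unitfE det_map_mx. Qed.

(** Semicontinuity of the rank: where [G] from [kernel_shift] is invertible, it embeds the kernel at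
    [t] into the kernel at 0. *)
Lemma almost_all_rank_ge p q (M : 'M[{poly F}]_(p, q)) :
  almost_all (fun t => \rank M.<[0]> <= \rank M.<[t]>)%N.
Proof.
have [G [G0 kG]] := kernel_shift M; exists (\det G); first exact: det_neq0 G0.
move=> t /det_eval_unit uG; have := mxrankS (kG t).
rewrite mxrankMfree ?row_free_unit // !mxrank_ker.
by have := rank_leq_row M.<[t]>; have := rank_leq_row M.<[0]>; lia.
Qed.

Lemma kernel_lift p q (M : 'M[{poly F}]_(p, q)) (u : 'rV[F]_p) :
  infinite_field -> almost_all (fun t => \rank M.<[t]> <= \rank M.<[0]>)%N ->
  u *m M.<[0]> = 0 ->
  exists2 c : 'rV[{poly F}]_p, c.<[0]> = u & c *m M = 0.
Proof.
move=> infF rM uM; have [G [G0 kG]] := kernel_shift M.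
(* G(t) maps ker M(t) injectively, hence by the rank bound bijectively, to
   ker M(0); c is u G^-1 with the denominator cleared. *)
exists (lift u *m \adj G).
  by rewrite map_mxM evalC map_mx_adj G0 -[\adj _]mul1mx mul_mx_adj det1 mulmx1.
apply/matrixP => i j; rewrite [RHS]mxE; apply: almost_all_poly_eq0 => //.
have aG : almost_all (fun t => (\det G).[t] != 0).
  by exists (\det G); rewrite ?(det_neq0 G0).
apply: almost_all_imp (almost_all_and rM aG) => t [rMt Gt].
have uG := det_eval_unit Gt.
suff /matrixP/(_ i j) : (lift u *m \adj G *m M).<[t]> = 0 by rewrite !mxE.
rewrite !map_mxM evalC map_mx_adj.
have /submxP[v uE] : (u <= kermx M.<[t]> *m G.<[t]>)%MS.
  apply: submx_trans (_ : kermx M.<[0]> <= _)%MS; first exact/sub_kermxP.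
  rewrite -(geq_leqif (mxrank_leqif_sup (kG t))) mxrankMfree ?row_free_unit //.
  by rewrite !mxrank_ker leq_sub2l.
move: (kermx _) (mulmx_ker M.<[t]>) uE => K KM ->.
rewrite -!mulmxA [_ *m (\adj _ *m _)]mulmxA mul_mx_adj mul_scalar_mx.
by rewrite -!scalemxAr KM mulmx0 scaler0.
Qed.

End AlmostAll.

(* At least the terms of degree 0 and 1 are always present. *)
Definition curve (F : fieldType) (X : lmodType F) n (c : nat -> X) (t : F) : X :=
  \sum_(i < n.+2) t ^+ i *: c i.

(** * Polynomial curves of linear maps and of vectors in their kernels *)

Section LfunCurves.
Variable F : fieldType.
Import VectorInternalTheory.

Lemma curve0 (X : lmodType F) n (c : nat -> X) : curve n c 0 = c 0%N.
Proof.
rewrite /curve big_ord_recl expr0 scale1r big1 ?addr0 // => i _.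
by rewrite expr0n scale0r.
Qed.

Lemma lfun_mxE (X Y : vectType F) (f : 'Hom(X, Y)) x : v2r (f x) = v2r x *m f2mx f.
Proof. by rewrite unlock /= r2vK. Qed.

Lemma rank_f2mx (X Y : vectType F) (f : 'Hom(X, Y)) : \rank (f2mx f) = \dim (limg f).
Proof.
have := limg_ker_dim f fullv; rewrite capfv dimvf.
rewrite {1}/dimv mx2vsK mxrank_ker; have := rank_leq_row (f2mx f); lia.
Qed.

Lemma f2mx_curve (X Y : vectType F) n (A : nat -> 'Hom(X, Y)) t :
  f2mx (curve n A t) = \sum_(i < n.+2) t ^+ i *: f2mx (A i).
Proof.
apply/row_matrixP => k; rewrite !rowE -[delta_mx _ _](@r2vK _ X) -lfun_mxE.
rewrite sum_lfunE linear_sum mulmx_sumr; apply: eq_bigr => i _.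
by rewrite scale_lfunE linearZ /= lfun_mxE scalemxAr.
Qed.

Definition curve_mx (X Y : vectType F) n (A : nat -> 'Hom(X, Y)) :=
  \matrix_(i, j) \poly_(k < n.+2) f2mx (A k) i j.

Lemma curve_mx_eval (X Y : vectType F) n (A : nat -> 'Hom(X, Y)) t :
  (curve_mx n A).<[t]> = f2mx (curve n A t).
Proof.
apply/matrixP => i j; rewrite f2mx_curve summxE !mxE /horner_eval horner_poly.
by apply: eq_bigr => k _; rewrite mxE mulrC.
Qed.

Lemma almost_all_dim_ge (X Y : vectType F) n (A : nat -> 'Hom(X, Y)) :
  almost_all (fun t => \dim (limg (A 0%N)) <= \dim (limg (curve n A t)))%N.
Proof.
apply: almost_all_imp (almost_all_rank_ge (curve_mx n A)) => t.
by rewrite !curve_mx_eval !rank_f2mx curve0.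
Qed.

Lemma lfun_kernel_lift (X Y : vectType F) n (A : nat -> 'Hom(X, Y)) x :
  infinite_field F ->
  almost_all (fun t => \dim (limg (curve n A t)) <= \dim (limg (A 0%N)))%N ->
  A 0%N x = 0 ->
  exists m c, [/\ c 0%N = x, A 0%N (c 1%N) = - A 1%N x &
    forall t, curve n A t (curve m c t) = 0].
Proof.
move=> infF rA A0x.
have [||c c0 cM] := kernel_lift (M := curve_mx n A) (u := v2r x) infF.
- by apply: almost_all_imp rA => t; rewrite !curve_mx_eval !rank_f2mx curve0.
- by rewrite curve_mx_eval curve0 -lfun_mxE A0x linear0.
pose a k := r2v (\row_j (c 0 j)`_k) : X.
(* A common degree bound for the entries of [c]; the shift by 2 is the one in [curve]. *)
have sc j : (size (c 0%R j) <= (\max_j size (c 0%R j)).+2)%N.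
  by rewrite !leqW // (leq_bigmax j).
exists (\max_j size (c 0%R j)), a; split.
- apply: (@v2r_inj _ X); rewrite r2vK -c0; apply/rowP => j.
  by rewrite !mxE /horner_eval horner_coef0.
(* Compare coefficients of degree 1 in [c *m M = 0]. *)
- apply: (@v2r_inj _ Y); rewrite linearN /= !lfun_mxE r2vK; apply/rowP => j.
  have := congr1 (fun M : 'rV[{poly F}]_(_) => (M 0 j)`_1) cM.
  rewrite !mxE coef0 coef_sum => E; apply/eqP; rewrite -addr_eq0 -big_split /=.
  apply/eqP; rewrite -[X in _ = X]E; apply/eq_bigr => k _.
  rewrite coefM !big_ord_recl big_ord0 addr0 !mxE !coef_poly /= addrC.
  by rewrite -c0 mxE /horner_eval horner_coef0.
- move=> t; apply: (@v2r_inj _ Y); rewrite lfun_mxE linear0 -curve_mx_eval.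
  suff -> : v2r (curve (\max_j size (c 0%R j)) a t) = c.<[t]>.
    by rewrite -map_mxM cM map_mx0.
  rewrite linear_sum; apply/rowP => j; rewrite summxE mxE /horner_eval.
  rewrite (horner_coef_wide _ (sc j)); apply: eq_bigr => k _.
  by rewrite linearZ /= r2vK !mxE mulrC.
Qed.

(** Differentiate the lifted kernel vector at 0. This is the tangent condition to the locus of maps
    of bounded rank. *)
Lemma lfun_tangent (X Y : vectType F) n (A : nat -> 'Hom(X, Y)) x :
  infinite_field F ->
  almost_all (fun t => \dim (limg (curve n A t)) <= \dim (limg (A 0%N)))%N ->
  A 0%N x = 0 -> A 1%N x \in limg (A 0%N).
Proof.
move=> infF rA /(lfun_kernel_lift infF rA)[m [c [_ A0c _]]].
by rewrite -memvN -A0c memv_img ?memvf.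
Qed.

End LfunCurves.

(** * Componentwise linear maps between direct sums *)

Section DsumMaps.
Variable F : fieldType.

Lemma limg_dim_le (X Y : vectType F) (f : 'Hom(X, Y)) (S : {vspace X}) :
  (\dim (f @: S) <= \dim S)%N.
Proof. by rewrite -[leqRHS](limg_ker_dim f) leq_addl. Qed.

Lemma dim_rV k : \dim {: 'rV[F]_k} = k.
Proof. by rewrite dimvf /dim /= mul1n. Qed.

Section Compose.
Variables (A B C : vectType F).

Definition postcomp_fun (h : 'Hom(B, C)) (f : 'Hom(A, B)) : 'Hom(A, C) := (h \o f)%VF.
Fact postcomp_is_linear h : linear (postcomp_fun h).
Proof. by move=> k f g; rewrite /postcomp_fun comp_lfunDr -comp_lfunZr. Qed.
HB.instance Definition _ h :=
  GRing.isLinear.Build F 'Hom(A, B) 'Hom(A, C) _ (postcomp_fun h) (postcomp_is_linear h).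
Definition postcomp h : 'Hom('Hom(A, B), 'Hom(A, C)) := linfun (postcomp_fun h).

Definition precomp_fun (f : 'Hom(A, B)) (h : 'Hom(B, C)) : 'Hom(A, C) := (h \o f)%VF.
Fact precomp_is_linear f : linear (precomp_fun f).
Proof. by move=> k h g; rewrite /precomp_fun comp_lfunDl -comp_lfunZl. Qed.
HB.instance Definition _ f :=
  GRing.isLinear.Build F 'Hom(B, C) 'Hom(A, C) _ (precomp_fun f) (precomp_is_linear f).
Definition precomp f : 'Hom('Hom(B, C), 'Hom(A, C)) := linfun (precomp_fun f).

Lemma postcompE h f : postcomp h f = (h \o f)%VF. Proof. exact: lfunE. Qed.
Lemma precompE f h : precomp f h = (h \o f)%VF. Proof. exact: lfunE. Qed.

End Compose.

Section DsumMap.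
Variables (I : finType) (X Y : I -> vectType F) (g : forall i, 'Hom(X i, Y i)).

Definition dsum_map_fun (f : {dffun forall i, X i}) : {dffun forall i, Y i} :=
  [ffun i => g i (f i)].
Fact dsum_map_is_linear : linear dsum_map_fun.
Proof.
by move=> k f h; apply/ffunP => i; rewrite !(dsumD, dsumZ, ffunE) linearP.
Qed.
HB.instance Definition _ := GRing.isLinear.Build F
  {dffun forall i, X i} {dffun forall i, Y i} _ dsum_map_fun dsum_map_is_linear.
Definition dsum_map : 'Hom({dffun forall i, X i}, {dffun forall i, Y i}) :=
  linfun dsum_map_fun.

Lemma dsum_mapE f i : dsum_map f i = g i (f i).
Proof. by rewrite lfunE /= ffunE. Qed.

Lemma dsum_map_limgP (h : {dffun forall i, Y i}) :
  reflect (forall i, h i \in limg (g i)) (h \in limg dsum_map).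
Proof.
apply: (iffP idP) => [/memv_imgP[f _ ->] i|hg].
  by rewrite dsum_mapE memv_img ?memvf.
have -> : h = dsum_map [ffun i => (g i)^-1%VF (h i)].
  by apply/ffunP => i; rewrite dsum_mapE ffunE limg_lfunVK.
by rewrite memv_img ?memvf.
Qed.

Lemma dsum_map_ker0 : (forall i, lker (g i) == 0%VS) -> lker dsum_map == 0%VS.
Proof.
move=> g0; apply/lker0P => f h /ffunP fh; apply/ffunP => i.
by have /lker0P := g0 i; apply; have := fh i; rewrite !dsum_mapE.
Qed.

End DsumMap.

Lemma postcomp_limg (A B C : vectType F) (h : 'Hom(B, C)) (f : 'Hom(A, C)) :
  (limg f <= limg h)%VS -> f \in limg (postcomp A h).
Proof.
move=> fh; have -> : f = postcomp A h (h^-1 \o f)%VF.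
  apply/lfunP => v; rewrite postcompE !comp_lfunE limg_lfunVK //.
  by rewrite (subvP fh) // memv_img ?memvf.
by rewrite memv_img ?memvf.
Qed.

(** [h^-1 (h v)] differs from [v] by an element of [lker h], which [f] kills. *)
Lemma precomp_limg (A B C : vectType F) (h : 'Hom(A, B)) (f : 'Hom(A, C)) :
  (lker h <= lker f)%VS -> f \in limg (precomp C h).
Proof.
move=> hf; have -> : f = precomp C h (f \o h^-1)%VF.
  apply/lfunP => v; rewrite precompE !comp_lfunE; apply/eqP.
  rewrite -subr_eq0 -linearB /= -memv_ker (subvP hf) // memv_ker linearB /=.
  by rewrite limg_lfunVK ?subrr // memv_img ?memvf.
by rewrite memv_img ?memvf.
Qed.

Section HomInto.
Variables (I : finType) (A B : I -> vectType F) (U : forall i, {vspace B i}).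

(** Encoded as the image of an injective map, composition with the inclusions of the [U i], so that
    its dimension can be read off. *)
Definition hom_into : {vspace {dffun forall i, 'Hom(A i, B i)}} :=
  limg (dsum_map (fun i => postcomp (A i) (linfun (@vsval _ _ (U i))))).

Lemma limg_vsval (i : I) : limg (linfun (@vsval _ _ (U i))) = U i.
Proof.
apply/eqP; rewrite eqEsubv; apply/andP; split; apply/subvP => u.
  by move=> /memv_imgP[v _ ->]; rewrite lfunE subvsP.
move=> uU; apply/memv_imgP; exists (vsproj (U i) u); first exact: memvf.
by rewrite lfunE /= vsprojK.
Qed.

Lemma mem_hom_into (f : {dffun forall i, 'Hom(A i, B i)}) :
  reflect (forall i, limg (f i) <= U i)%VS (f \in hom_into).
Proof.
apply: (iffP (dsum_map_limgP _ _)) => fU i; last first.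
  by apply: postcomp_limg; rewrite limg_vsval.
have /memv_imgP[g _ ->] := fU i.
by rewrite postcompE limg_comp -[X in (_ <= X)%VS]limg_vsval limgS ?subvf.
Qed.

Lemma dim_hom_into :
  \dim hom_into = (\sum_i \dim {: A i} * \dim (U i))%N.
Proof.
rewrite limg_dim_eq; last first.
  apply/eqP; rewrite capfv; apply: dsum_map_ker0 => i; apply/lker0P => f g.
  rewrite !postcompE => fg; apply/lfunP => v; apply: subvs_inj.
  by have := congr1 (fun h : 'Hom(_, _) => h v) fg; rewrite !comp_lfunE !lfunE.
by rewrite dim_dsum; apply: eq_bigr => i _; rewrite !dimvf.
Qed.

End HomInto.

End DsumMaps.

(** * Factor representations *)

Section Reps.
Variables (F : fieldType) (Q : quiver).

Definition limg_rep (V W : rep F Q) (phi : vert_hom V W) x : {vspace W x} := limg (phi x).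

Lemma limg_subrep (V W : rep F Q) (phi : vert_hom V W) :
  is_morphism phi -> subrep (limg_rep phi).
Proof.
by move=> phiV a; rewrite /limg_rep -limg_comp -phiV limg_comp limgS ?subvf.
Qed.

(** Composition with [pi] is onto and respects the images of [hom_diff], so it induces a surjection
    from Ext(V,W) to Ext(V,W''); the Euler form then bounds the dimension of the latter from
    below. *)
Lemma dimExt_ge_factor (V W W'' : rep F Q) : factor_rep W W'' ->
  - euler (rep_dimvec V) (rep_dimvec W'') <= (dimExt V W)%:Z.
Proof.
move=> [U _ [pi piW piU]].
pose p : 'Hom(arrow_hom V W, arrow_hom V W'') :=
  dsum_map (fun a => postcomp (V (ta a)) (pi (ha a))).
have pT : limg p = fullv.
  apply/eqP; rewrite eqEsubv subvf; apply/subvP => f _; apply/dsum_map_limgP => a.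
  by apply: postcomp_limg; rewrite (piU _).1 subvf.
have pI : (p @: limg (hom_diff V W) <= limg (hom_diff V W''))%VS.
  apply/subvP => _ /memv_imgP[_ /memv_imgP[h _ ->] ->].
  have -> : p (hom_diff V W h) =
      hom_diff V W'' [ffun x => (pi x \o h x)%VF].
    apply/ffunP => a; rewrite !lfunE /= !ffunE postcompE comp_lfunDr comp_lfunNr.
    by rewrite !comp_lfunA piW.
  by rewrite memv_img ?memvf.
rewrite -dimHomBdimExt opprB lerBlDr -PoszD lez_nat /dimExt.
have e1 : (\dim (lker p) + \dim {: arrow_hom V W''} = \dim {: arrow_hom V W})%N.
  by have := limg_ker_dim p fullv; rewrite pT capfv.
have e2 : (\dim (limg (hom_diff V W)) <= \dim {: arrow_hom V W})%N.
  exact: dimvS (subvf _).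
have := limg_ker_dim p (limg (hom_diff V W)).
have := dimvS pI; have := dimvS (capvSr (limg (hom_diff V W)) (lker p)).
move: e1 e2; lia.
Qed.

(** The quotient is realised on complements of the [U x], with the projections along [U x]. *)
Lemma quotient_exists (W : rep F Q) (U : forall x, {vspace W x}) : subrep U ->
  exists2 W'' : rep F Q, factor_rep W W'' &
    forall x, (rep_dimvec W'' x + \dim (U x))%N = rep_dimvec W x.
Proof.
move=> sU; pose C x : {vspace W x} := ((U x)^C)%VS.
pose pi x : 'Hom(W x, subvs_of (C x)) :=
  (linfun (@vsproj _ _ (C x)) \o (\1 - projv (U x)))%VF.
have piE x w : vsval (pi x w) = w - projv (U x) w.
  rewrite comp_lfunE lfunE /= add_lfunE opp_lfunE id_lfunE vsprojK //.
  exact: memv_projC.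
have piU x w : (pi x w == 0) = (w \in U x).
  rewrite -(inj_eq (@subvs_inj _ _ _)) piE raddf0 subr_eq0.
  by apply/eqP/idP => [->|/projv_id->//]; rewrite memv_proj.
pose W'' : rep F Q := Rep (fun x => subvs_of (C x) : vectType F)
  (fun a => (pi (ha a) \o rep_map W a \o linfun vsval)%VF).
exists W''; last first.
  by move=> x; rewrite /rep_dimvec dimvf /dim /= dimv_compl subnK // dimvS ?subvf.
exists U => //; exists ([ffun x => pi x] : vert_hom W W'').
  move=> a; apply/lfunP => w; rewrite !ffunE.
  rewrite [LHS]comp_lfunE [RHS]comp_lfunE /=.
  rewrite [RHS]comp_lfunE [RHS]comp_lfunE.
  have -> : linfun vsval (pi (ta a) w) = w - projv (U (ta a)) w by rewrite lfunE /= piE.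
  (* The two sides differ by [pi] of the image under [W] of a vector of [U], and [U] is a
     subrepresentation. *)
  apply/eqP; rewrite -subr_eq0 -!linearB piU opprB addrC subrK.
  by rewrite (subvP (sU a)) // memv_img // memv_proj.
move=> x; rewrite ffunE; split.
  apply/eqP; rewrite eqEsubv subvf; apply/subvP => u _.
  have -> : u = pi x (vsval u).
    apply: subvs_inj; rewrite piE; apply/eqP; rewrite -subr_eq0 opprB addrC subrK.
    by rewrite -memv_ker lker_proj subvsP.
  by rewrite memv_img ?memvf.
by apply/vspaceP => w; rewrite memv_ker piU.
Qed.

End Reps.

(** * Infinite fields *)

Section InfiniteField.
Variables (F : fieldType) (Q : quiver).

Definition line (X : lmodType F) (a b : X) k : X :=
  if k is k'.+1 then if k' is _.+1 then 0 else b else a.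

Lemma curve_line (X : lmodType F) (a b : X) t : curve 0 (line a b) t = a + t *: b.
Proof. by rewrite /curve !big_ord_recl big_ord0 addr0 /= expr0 scale1r expr1. Qed.

Lemma hom_diffE (V W : rep F Q) (h : vert_hom V W) a v :
  hom_diff V W h a v = h (ha a) (rep_map V a v) - rep_map W a (h (ta a) v).
Proof. by rewrite lfunE [hom_diff_fun _ _]ffunE add_lfunE opp_lfunE !comp_lfunE. Qed.

Lemma limg_subrep_of (V W : rep F Q) (phi : vert_hom V W) :
  hom_diff V W phi = 0 -> subrep (limg_rep phi).
Proof. by move=> phi0; apply/limg_subrep/mem_HomQ; rewrite memv_ker phi0. Qed.

Section ArrowHom.
Variables (V W : rep F Q) (f g : arrow_hom V W) (a : arrow Q) (v : V (ta a)).

Lemma arrow_homD : (f + g) a v = f a v + g a v.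
Proof. by rewrite dsumD add_lfunE. Qed.
Lemma arrow_homN : (- f) a v = - f a v.
Proof. by rewrite dsumN opp_lfunE. Qed.
Lemma arrow_homZ t : (t *: f) a v = t *: f a v.
Proof. by rewrite dsumZ scale_lfunE. Qed.

End ArrowHom.

Variables (n : dimvec Q) (W : rep F Q).

Local Notation VH := (vert_hom (rep_of (0 : Rep_alpha F n)) W).
Local Notation AH := (arrow_hom (rep_of (0 : Rep_alpha F n)) W).
(** The types of [vert_hom] and [arrow_hom] depend on the spaces of [V] and not on its maps. Fixing
    the zero representation in [VH] and [AH] puts the differentials of all [V] in one vector
    space. *)
Definition hom_diff_of (V : Rep_alpha F n) : 'Hom(VH, AH) := hom_diff (rep_of V) W.

Lemma hom_diff_ofE V (h : VH) a v :
  hom_diff_of V h a v = h (ha a) (V a v) - rep_map W a (h (ta a) v).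
Proof. exact: (@hom_diffE (rep_of V) W h a v). Qed.

(* The linear family t |-> hom_diff_of (V + t *: D). *)
Definition pencil (V D : Rep_alpha F n) : nat -> 'Hom(VH, AH) :=
  line (hom_diff_of V) (hom_diff_of D - hom_diff_of 0).

(** Subtracting [hom_diff_of 0] cancels the term in the maps of [W]. *)
Lemma pencil1E V D (h : VH) a v : pencil V D 1%N h a v = h (ha a) (D a v).
Proof.
rewrite /pencil /line (add_lfunE (hom_diff_of D)) (opp_lfunE (hom_diff_of 0)).
rewrite arrow_homD arrow_homN !hom_diff_ofE dsum0 zero_lfunE linear0 sub0r.
by rewrite opprK subrK.
Qed.

Lemma curve_pencil V D t : curve 0 (pencil V D) t = hom_diff_of (V + t *: D).
Proof.
rewrite curve_line -[_ - _]/(pencil V D 1%N).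
apply/lfunP => h; apply/ffunP => a; apply/lfunP => v.
rewrite (add_lfunE (hom_diff_of V)) (scale_lfunE t).
rewrite arrow_homD arrow_homZ pencil1E !hom_diff_ofE.
by rewrite dsumD add_lfunE dsumZ scale_lfunE linearD linearZ /= addrAC.
Qed.

Lemma vert_curveE m (c : nat -> VH) t x :
  curve m c t x = curve m (fun k => c k x) t.
Proof.
rewrite /curve; elim/big_ind2: _ => [|? f ? g <- <-|i _]; first by rewrite dsum0.
  by rewrite dsumD.
by rewrite dsumZ.
Qed.

(** * Morphisms of maximal rank from a general representation *)

Section Tangent.
Hypothesis infF : infinite_field F.
Variables (V : Rep_alpha F n) (phi : VH).
Hypothesis V_general : forall V',
  (\dim (limg (hom_diff_of V')) <= \dim (limg (hom_diff_of V)))%N.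
Hypothesis phi_hom : hom_diff_of V phi = 0.
Hypothesis phi_max : forall V' psi,
  (\dim (limg (hom_diff_of V)) <= \dim (limg (hom_diff_of V')))%N ->
  hom_diff_of V' psi = 0 ->
  (\sum_x \dim (limg (psi x)) <= \sum_x \dim (limg (phi x)))%N.

Local Notation U := (limg_rep phi).

(* The psi with psi(ker phi) <= im phi: modulo maps into im phi, these factor
   through phi. *)
Definition tangent : {vspace VH} :=
  (hom_into (fun x => 'rV[F]_(n x) : vectType F) U
   + limg (dsum_map (fun x => precomp (W x) (phi x))))%VS.

(** Maximality of [phi] keeps the rank at each vertex constant along the curve, so [lfun_tangent]
    applies at each vertex. *)
Lemma curve_tangent m (c : nat -> VH) : c 0%N = phi ->
  almost_all (fun t => exists2 V',
    (\dim (limg (hom_diff_of V)) <= \dim (limg (hom_diff_of V')))%N &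
    hom_diff_of V' (curve m c t) = 0) ->
  c 1%N \in tangent.
Proof.
move=> c0 cV.
have ge : almost_all (fun t => forall x,
    \dim (limg (c 0%N x)) <= \dim (limg (curve m (fun k => c k x) t)))%N.
  by apply: almost_all_fin => x; apply: almost_all_dim_ge.
(* No rank drops and their sum does not rise, so no single rank rises. *)
have le x : almost_all (fun t =>
    \dim (limg (curve m (fun k => c k x) t)) <= \dim (limg (c 0%N x)))%N.
  apply: almost_all_imp (almost_all_and cV ge) => t [[V' V'g /(phi_max V'g) lt_s] ge_t].
  rewrite leqNgt; apply/negP => gt_x; move: lt_s; rewrite leqNgt => /negP; apply.
  rewrite (bigD1 x) //= [ltnRHS](bigD1 x) //= -addSn vert_curveE -c0.
  by rewrite leq_add //; apply: leq_sum => y _; rewrite vert_curveE.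
(* [s] is the part of [c 1] inside the image of [phi]; the rest kills the kernel of [phi] and hence
   factors through [phi]. *)
pose s : VH := [ffun x => (projv (U x) \o c 1%N x)%VF].
rewrite -[c 1%N](subrKC s); apply: memv_add.
  apply/mem_hom_into => x; rewrite ffunE limg_comp; apply/subvP.
  by move=> _ /memv_imgP[v _ ->]; rewrite memv_proj.
apply/dsum_map_limgP => x; apply: precomp_limg; apply/subvP => v.
rewrite !memv_ker => /eqP phiv.
rewrite dsumD dsumN ffunE add_lfunE opp_lfunE comp_lfunE projv_id ?subrr //.
have := lfun_tangent infF (le x); rewrite c0; exact.
Qed.

(** [psi] is the derivative of the line [phi + t *: psi] of morphisms from [V]. *)
Lemma ker_tangent : (lker (hom_diff_of V) <= tangent)%VS.
Proof.
apply/subvP => psi; rewrite memv_ker => /eqP psi_hom.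
apply: (curve_tangent (m := 0) (c := line phi psi)) => //.
exists 1; rewrite ?oner_neq0 // => t _; exists V => //.
by rewrite curve_line linearD linearZ /= phi_hom psi_hom scaler0 addr0.
Qed.

(** A family [f] into the image of [phi] is [phi] composed with some [D]. Lifting [phi] along
    [V + t *: D] and differentiating at 0 gives a tangent vector whose differential is [- f]. *)
Lemma hom_into_tangent :
  (hom_into (fun a : arrow Q => 'rV[F]_(n (ta a)) : vectType F)
            (fun a : arrow Q => U (ha a)) <= hom_diff_of V @: tangent)%VS.
Proof.
apply/subvP => f /mem_hom_into fU.
have /dsum_map_limgP/memv_imgP[D _ fE] : forall a,
    f a \in limg (postcomp ('rV[F]_(n (ta a)) : vectType F) (phi (ha a))).
  by move=> a; apply: postcomp_limg.
have [||m [c [c0 c1 cV]]] := lfun_kernel_lift (n := 0) (A := pencil V D) (x := phi) infF.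
- by exists 1; rewrite ?oner_neq0 // => t _; rewrite curve_pencil.
- by [].
suff -> : f = hom_diff_of V (- c 1%N).
  apply: memv_img; rewrite memvN; apply: curve_tangent c0 _.
  (* For almost all [t], [V + t *: D] is still general. *)
  apply: almost_all_imp (almost_all_dim_ge 0 (pencil V D)) => t.
  by rewrite curve_pencil => ge; exists (V + t *: D) => //; rewrite -curve_pencil.
rewrite linearN /= [hom_diff_of V _]c1 opprK.
apply/ffunP => a; apply/lfunP => v.
by rewrite pencil1E fE dsum_mapE postcompE comp_lfunE.
Qed.

(** Rank and nullity of [hom_diff_of V] on [tangent]. Maps factoring through [phi] come from
    endomorphisms of the [W x], whence a term independent of [n]. *)
Lemma dim_ker_le :
  (\dim (lker (hom_diff_of V)) + \sum_a n (ta a) * \dim (U (ha a))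
   <= \sum_x n x * \dim (U x) + \sum_x \dim {: W x} * \dim {: W x})%N.
Proof.
have := dimvS hom_into_tangent; rewrite dim_hom_into.
under eq_bigr do rewrite dim_rV; move=> le1.
have le2 : (\dim tangent
    <= \sum_x n x * \dim (U x) + \sum_x \dim {: W x} * \dim {: W x})%N.
  apply: leq_trans (dimv_add_leqif _ _) _; rewrite dim_hom_into.
  under eq_bigr do rewrite dim_rV.
  rewrite leq_add2l; apply: leq_trans (limg_dim_le _ _) _.
  by rewrite dim_dsum; apply: leq_sum => x _; rewrite !dimvf.
rewrite (leq_trans _ le2) // -(limg_ker_dim (hom_diff_of V) tangent).
by rewrite (capv_idPr ker_tangent) leq_add2l.
Qed.

End Tangent.

End InfiniteField.

(** The bound dim Hom(V,W) <= <n, dim U> + C, with the arrow term moved to the left to stay within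
    natural numbers. *)
Definition small_hom (F : fieldType) (Q : quiver) (n : dimvec Q) (W : rep F Q) :=
  exists (V : Rep_alpha F n) (U : forall x, {vspace W x}), subrep U /\
  (dimHom (rep_of V) W + \sum_a n (ta a) * \dim (U (ha a))
   <= \sum_x n x * \dim (U x) + \sum_x \dim {: W x} * \dim {: W x})%N.

Lemma small_hom_infinite (F : fieldType) (Q : quiver) (n : dimvec Q) (W : rep F Q) :
  infinite_field F -> small_hom n W.
Proof.
move=> infF.
pose r (V : Rep_alpha F n) := \dim (limg (hom_diff_of W V)).
have [V0 V0_max]: exists V0, forall V, (r V <= r V0)%N.
  pose P k := `[< exists V, r V = k >].
  have exP : exists k, P k by exists (r 0); apply/asboolP; exists 0.
  have [k /asboolP[V Vk]|k /asboolP[V <-] kmax] := ex_maxnP (P := P)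
    (m := \dim {: arrow_hom (rep_of (0 : Rep_alpha F n)) W}) exP.
    by rewrite -Vk; apply: dimvS; apply: subvf.
  by exists V => V'; apply: kmax; apply/asboolP; exists V'.
pose s (phi : vert_hom (rep_of (0 : Rep_alpha F n)) W) := (\sum_x \dim (limg (phi x)))%N.
(* The rank is maximised over [V] and [phi] together, so the resulting [V] may differ from [V0]. *)
pose P k := `[< exists V phi,
  [/\ (r V0 <= r V)%N, hom_diff_of W V phi = 0 & s phi = k] >].
have exP : exists k, P k.
  by exists (s 0); apply/asboolP; exists V0, 0; rewrite linear0.
have [k /asboolP[V [phi [_ _ <-]]]|k /asboolP[V [phi [V_ge phiV <-]]] kmax] :=
    ex_maxnP (P := P) (m := \sum_x \dim {: W x}) exP.
  by apply: leq_sum => x _; apply: dimvS; apply: subvf.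
exists V, (limg_rep phi); split.
  have sU := @limg_subrep_of F Q (rep_of V) W phi phiV.
  exact: sU.
apply: dim_ker_le => // [V'|V' psi V'_ge psiV'].
  exact: leq_trans (V0_max V') V_ge.
apply: kmax; apply/asboolP; exists V', psi; split=> //.
exact: leq_trans V_ge V'_ge.
Qed.

(** * Finite fields *)

Section Counting.
Variable F : finFieldType.
Local Notation q := #|F|.
Local Open Scope nat_scope.

Lemma sum_mem_vspace (X : vectType F) (U : {vspace X}) :
  \sum_(v : finvect_type X) (v \in U) = q ^ \dim U.
Proof.
case: X U => X cX U; rewrite -(@card_vspace F (finvect_type (Vector.Pack cX)) cX U).
by rewrite -sum1_card [RHS]big_mkcond; apply: eq_bigr => v _; case: (v \in U).
Qed.

Lemma card_finvect (X : vectType F) : #|{: finvect_type X}| = q ^ \dim {: X}.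
Proof.
rewrite -sum_mem_vspace -sum1_card; apply: eq_bigr => v _.
by rewrite memvf.
Qed.

Lemma leq_sum_affine (X : vectType F) (U : {vspace X}) (P : pred X) :
  (forall v w, P v -> P w -> (v - w)%R \in U) ->
  \sum_(v : finvect_type X) P v <= q ^ \dim U.
Proof.
move=> PU; have [v0 Pv0|noP] := pickP (fun v : finvect_type X => P v); last first.
  by rewrite big1 // => v _; rewrite noP.
rewrite -sum_mem_vspace (reindex (fun v : finvect_type X => v + v0)%R) /=; last first.
  by exists (fun v => v - v0)%R => v _; rewrite ?addrK ?subrK.
apply: leq_sum => v _; case Pv: (P _) => //=.
by have := PU _ _ Pv Pv0; rewrite addrK => ->.
Qed.

(* Double counting of the pairs (V, phi) with phi in K V: the phi with p phi = z
   lie in S z, and the V with phi in K V differ by elements of L phi. *)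
Lemma incidence_count (X Y Z : vectType F) (K : X -> {vspace Y}) (p : Y -> Z)
    (S : Z -> {vspace Y}) (L : Y -> {vspace X}) h :
  (forall V, h <= \dim (K V)) ->
  (forall phi, phi \in S (p phi)) ->
  (forall V V' phi, phi \in K V -> phi \in K V' -> (V - V')%R \in L phi) ->
  exists V phi, phi \in K V /\
    h + \dim {: X} <= \dim (S (p phi)) + \dim (L phi) + \dim {: Z}.
Proof.
move=> hK pS KL; apply: contrapT => noV.
pose c (phi : finvect_type Y) := \sum_(V : finvect_type X) (phi \in K V).
have q1 : 1 < q := finNzRing_gt1 F.
(* By [noV] the inequality of exponents is strict; the last factor [q] records this. *)
have c_le phi : c phi * q ^ \dim (S (p phi)) * q ^ \dim {: Z} * q <= q ^ (h + \dim {: X}).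
  have [V phiV|noK] := pickP (fun V : finvect_type X => phi \in K V); last first.
    by rewrite /c big1 // => V _; rewrite noK.
  have cL : c phi <= q ^ \dim (L phi).
    by apply: (@leq_sum_affine X (L phi) (fun V => phi \in K V)) => V1 V2; apply: KL.
  apply: leq_trans (leq_mul (leq_mul (leq_mul cL (leqnn _)) (leqnn _)) (leqnn _)) _.
  rewrite -!expnD -expnSr leq_exp2l // ltnNge; apply/negP => le; apply: noV.
  by exists V, phi; split=> //; move: le; lia.
(* The fibre over [z] lies in [S z], so it has at most [q ^ \dim (S z)] elements. *)
have fib z : (\sum_(phi : finvect_type Y | p phi == z) c phi) * q ^ \dim {: Z} * q
    <= q ^ (h + \dim {: X}).
  have qS : 0 < q ^ \dim (S z) by rewrite expn_gt0 ltnW.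
  rewrite -(leq_pmul2l qS) !big_distrl big_distrr /=.
  apply: (@leq_trans (\sum_(phi : finvect_type Y | p phi == z) q ^ (h + \dim {: X}))).
    apply: leq_sum => phi pz; apply: leq_trans (c_le phi); rewrite -(eqP pz).
    by rewrite !mulnA [_ * c phi]mulnC.
  rewrite sum_nat_const leq_mul2r; apply/orP; right.
  rewrite -sum_mem_vspace -sum1_card big_mkcond; apply: leq_sum => phi _.
  by rewrite unfold_in; case: ifP => // pz; rewrite -(eqP pz) pS.
(* Each [V] lies in at least [q ^ h] pairs, so there are at least [q ^ (h + \dim {: X})] pairs;
   summing [fib] over [z] makes this too many. *)
suff: q ^ (h + \dim {: X}) * q <= q ^ (h + \dim {: X}).
  by rewrite -expnSr leq_exp2l // ltnn.
have qZ : 0 < q ^ \dim {: Z} by rewrite expn_gt0 ltnW.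
rewrite -(leq_pmul2l qZ) mulnA.
apply: (@leq_trans (\sum_(z : finvect_type Z) q ^ (h + \dim {: X}))); last first.
  by rewrite sum_nat_const card_finvect.
apply: leq_trans (leq_sum _ (fun z _ => fib z)).
rewrite -!big_distrl /= leq_mul2r; apply/orP; right.
rewrite mulnC leq_mul2r; apply/orP; right.
have <- : \sum_(phi : finvect_type Y) c phi =
    \sum_(z : finvect_type Z) \sum_(phi : finvect_type Y | p phi == z) c phi.
  exact: (@partition_big _ _ _ _ _ _ xpredT (p : finvect_type Y -> finvect_type Z) xpredT).
rewrite exchange_big /= expnD mulnC -card_finvect -sum_nat_const.
by apply: leq_sum => V _; rewrite sum_mem_vspace leq_exp2l.
Qed.

End Counting.

Lemma small_hom_finite (F : finFieldType) (Q : quiver) (n : dimvec Q) (W : rep F Q) :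
  small_hom n W.
Proof.
pose K (V : Rep_alpha F n) := lker (hom_diff_of W V).
have [V0 V0_min]: exists V0, forall V, (\dim (K V0) <= \dim (K V))%N.
  pose P k := `[< exists V, \dim (K V) = k >].
  have exP : exists k, P k by exists (\dim (K 0)); apply/asboolP; exists 0.
  have [k /asboolP[V <-] kmin] := ex_minnP exP.
  by exists V => V'; apply: kmin; apply/asboolP; exists V'.
pose VH := vert_hom (rep_of (0 : Rep_alpha F n)) W.
(* The projections onto the images of [phi] record the family of images as a point of a space whose
   dimension C does not depend on [n]. *)
pose p (phi : VH) : vert_hom W W := [ffun x => projv (limg (phi x))].
pose S (z : vert_hom W W) :=
  hom_into (fun x => 'rV[F]_(n x) : vectType F) (fun x => limg (z x)).
pose E (phi : VH) := dsum_map (fun a : arrow Q =>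
  postcomp ('rV[F]_(n (ta a)) : vectType F) (phi (ha a))).
have limg_p phi x : limg (p phi x) = limg (phi x) by rewrite ffunE limg_proj.
have [||V [phi [phiV le]]] :=
    @incidence_count F _ _ _ K p S (fun phi => lker (E phi)) _ V0_min.
- by move=> phi; apply/mem_hom_into => x; rewrite limg_p.
- move=> V V' phi; rewrite !memv_ker => /eqP phiV /eqP phiV'.
  apply/eqP/ffunP => a; apply/lfunP => v; rewrite dsum_mapE postcompE comp_lfunE.
  rewrite dsum0 zero_lfunE dsumD add_lfunE dsumN opp_lfunE linearB /=; apply/eqP.
  have EV D : hom_diff_of W D phi = 0 ->
      phi (ha a) (D a v) = rep_map W a (phi (ta a) v).
    move=> phiD; apply/eqP; rewrite -subr_eq0 -(hom_diff_ofE D phi) phiD.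
    by rewrite dsum0 zero_lfunE.
  by rewrite !EV ?subrr.
move: phiV; rewrite memv_ker => /eqP phiV.
(* The bound is for [V0], while [U] is the image of a morphism from a possibly different [V]. *)
exists V0, (limg_rep phi); split.
  have sU := @limg_subrep_of F Q (rep_of V) W phi phiV.
  exact: sU.
have dS : \dim (S (p phi)) = (\sum_x n x * \dim (limg_rep phi x))%N.
  by rewrite dim_hom_into; apply: eq_bigr => x _; rewrite dim_rV limg_p.
have dE : (\dim (lker (E phi)) + \sum_a n (ta a) * \dim (limg_rep phi (ha a))
    <= \dim {: Rep_alpha F n})%N.
  rewrite -(limg_ker_dim (E phi) fullv) capfv leq_add2l.
  have := dim_hom_into (fun a : arrow Q => 'rV[F]_(n (ta a)) : vectType F)
    (fun a => limg_rep phi (ha a)).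
  under eq_bigr do rewrite dim_rV; move=> <-; apply: dimvS.
  apply/subvP => f /mem_hom_into fU.
  by apply/dsum_map_limgP => a; apply: postcomp_limg.
have dZ : \dim {: vert_hom W W} = (\sum_x \dim {: W x} * \dim {: W x})%N.
  by rewrite [LHS]dim_dsum; apply: eq_bigr => x _; rewrite !dimvf.
have {le} : (\dim (K V0) + \dim {: Rep_alpha F n}
    <= \dim (S (p phi)) + \dim (lker (E phi)) + \dim {: vert_hom W W})%N := le.
rewrite dS dZ -[dimHom _ _]/(\dim (K V0)); move: dE.
set e := (\sum_a _)%N; set u := (\sum_x n x * _)%N; set w := (\sum_x _)%N.
move: (\dim {: Rep_alpha F n}) (\dim (lker _)) (\dim _) e u w.
lia.
Qed.

(** An equality of field types, so that the finite case transports to [F]. *)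
Lemma finite_fieldP (F : fieldType) (e : seq F) : (forall t, t \in e) ->
  exists fF : finFieldType, fF = F :> fieldType.
Proof.
move=> eF; have eK : cancel (index^~ e) (nth 0 e) by move=> t; rewrite nth_index.
pose cF := isCountable.Build F (pcan_pickleK (can_pcan eK)).
have eax : Finite.axiom (undup e).
  by move=> t; rewrite count_uniq_mem ?undup_uniq // mem_undup eF.
case: F e eF eK cF eax => T cT e eF eK cF eax.
pose fF : finFieldType := HB.pack T cT cF (isFinite.Build (GRing.Field.Pack cT) eax).
by exists fF.
Qed.

Lemma small_hom_exists (F : fieldType) (Q : quiver) (n : dimvec Q) (W : rep F Q) :
  small_hom n W.
Proof.
have [/small_hom_infinite//|/infinite_fieldPn[e /finite_fieldP[fF EF]]] :=
  pselect (infinite_field F).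
by case: _ / EF W => W; apply: small_hom_finite.
Qed.

(** * Growth of the general ext *)

Section Euler.
Variables (Q : quiver) (alpha : dimvec Q).

Lemma euler_scale d beta : euler (scale_dimvec d alpha) beta = d%:Z * euler alpha beta.
Proof.
rewrite /euler mulrBr !mulr_sumr; congr (_ - _); apply: eq_bigr => i _;
  by rewrite /scale_dimvec -mulnA PoszM.
Qed.

Lemma eulerD beta gamma : euler alpha (fun x => beta x + gamma x)%N =
  euler alpha beta + euler alpha gamma.
Proof.
rewrite /euler addrACA -opprD -!big_split /=; congr (_ - _); apply: eq_bigr => i _;
  by rewrite mulnDr PoszD.
Qed.

Lemma euler_natE beta : euler alpha beta =
  (\sum_x alpha x * beta x)%N%:Z - (\sum_a alpha (ta a) * beta (ha a))%N%:Z.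
Proof. by rewrite /euler !(big_morph Posz PoszD (erefl _)). Qed.

Lemma eq_euler beta gamma : beta =1 gamma -> euler alpha beta = euler alpha gamma.
Proof.
by move=> e; rewrite /euler; congr (_ - _); apply: eq_bigr => i _; rewrite e.
Qed.

End Euler.

Section GenericExt.
Variables (F : fieldType) (Q : quiver) (alpha : dimvec Q) (W : rep F Q).

Lemma rep_of_dimvec (V : Rep_alpha F alpha) : rep_dimvec (rep_of V) = alpha.
Proof. by apply/funext => x; exact: dim_rV. Qed.

Lemma ext_gen_ge (W'' : rep F Q) : factor_rep W W'' ->
  - euler alpha (rep_dimvec W'') <= (ext_gen alpha W)%:Z.
Proof.
move=> fW; have [V gV] := general_exists alpha W.
by rewrite -(ext_genE gV) -[alpha in euler alpha](rep_of_dimvec V) dimExt_ge_factor.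
Qed.

(** Take the quotient by the [U] of [small_hom]: since <alpha, dim W> = <alpha, dim W''> + <alpha,
    dim U>, the term in [U] cancels. *)
Lemma ext_gen_le : exists2 W'' : rep F Q, factor_rep W W'' &
  (ext_gen alpha W)%:Z <= - euler alpha (rep_dimvec W'')
    + (\sum_x \dim {: W x} * \dim {: W x})%N%:Z.
Proof.
have [V [U [sU le]]] := small_hom_exists alpha W.
have [W'' fW dW''] := quotient_exists sU; exists W'' => //.
have [V' gV'] := general_exists alpha W.
have hle : (hom_gen alpha W <= dimHom (rep_of V) W)%N.
  rewrite /hom_gen; case: ex_minnP => k _; apply; apply/asboolP.
  by exists V.
have := dimHomBdimExt (rep_of V') W; rewrite (ext_genE gV') gV' rep_of_dimvec.
rewrite -(eq_euler alpha dW'') eulerD [euler alpha (fun x => \dim (U x))]euler_natE.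
move: le hle; set c := (\sum_x _ * _)%N; set e := euler _ _.
move: (\sum_a _)%N (\sum_x _)%N (dimHom _ _) => a b h.
lia.
Qed.

End GenericExt.

Lemma max_factor_exists (F : fieldType) (Q : quiver) (alpha : dimvec Q) (W : rep F Q) :
  exists2 W0 : rep F Q, factor_rep W W0 & forall W'' : rep F Q, factor_rep W W'' ->
    - euler alpha (rep_dimvec W'') <= - euler alpha (rep_dimvec W0).
Proof.
(* Nonnegative before taking absz, by ext_gen_ge; so a minimal gap is a maximal
   value of -<alpha, dim W''>. *)
pose gap (W'' : rep F Q) := absz ((ext_gen alpha W)%:Z + euler alpha (rep_dimvec W'')).
pose P k := `[< exists2 W'' : rep F Q, factor_rep W W'' & gap W'' = k >].
have exP : exists k, P k.
  by have [W'' fW _] := ext_gen_le alpha W; exists (gap W''); apply/asboolP; exists W''.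
have [k /asboolP[W0 fW0 <-] kmin] := ex_minnP exP.
exists W0 => // W'' fW.
have : (gap W0 <= gap W'')%N by apply: kmin; apply/asboolP; exists W''.
have := ext_gen_ge alpha fW; have := ext_gen_ge alpha fW0; rewrite /gap.
move: (ext_gen alpha W) (euler _ _) (euler _ _) => e a b; lia.
Qed.

(** The error term is independent of [d], so it disappears after division by [d]. *)
Lemma ext_gen_scale_bounds (F : fieldType) (Q : quiver) (alpha : dimvec Q)
    (W : rep F Q) (m : int) d :
  (exists2 W0 : rep F Q, factor_rep W W0 & m = - euler alpha (rep_dimvec W0)) ->
  (forall W'' : rep F Q, factor_rep W W'' -> - euler alpha (rep_dimvec W'') <= m) ->
  d%:Z * m <= (ext_gen (scale_dimvec d alpha) W)%:Z
    <= d%:Z * m + (\sum_x \dim {: W x} * \dim {: W x})%N%:Z.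
Proof.
move=> [W0 fW0 ->] W0_max; apply/andP; split.
  by have := ext_gen_ge (scale_dimvec d alpha) fW0; rewrite euler_scale mulrN.
have [W'' fW le] := ext_gen_le (scale_dimvec d alpha) W.
apply: le_trans le _; rewrite lerD2r euler_scale -mulrN ler_wpM2l //.
exact: W0_max.
Qed.

(** * Passage to the limit *)

Local Open Scope classical_set_scope.

Theorem theorem4p6 (R : realType) (F : fieldType) (Q : quiver)
    (alpha : dimvec Q) (W : rep F Q) :
  cvgn (ncext_seq R alpha W) /\
  is_max [set m : R | exists2 W'' : rep F Q,
            factor_rep W W'' & m = (- euler alpha (rep_dimvec W''))%:~R]
         (ncext R alpha W).
Proof.
have [W0 fW0 W0_max] := max_factor_exists alpha W.
set M : int := - euler alpha (rep_dimvec W0).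
set C := (\sum_x \dim {: W x} * \dim {: W x})%N.
have lim_M : ncext_seq R alpha W @ \oo --> (M%:~R : R).
  (* The shift avoids division by [d = 0] and matches [harmonic d], which is 1/(d+1). *)
  rewrite -cvg_shiftS.
  have cvgC : (fun d => (M%:~R + C%:R * harmonic d : R)) @ \oo --> (M%:~R : R).
    rewrite -[X in _ --> X]addr0 -[X in _ + X](mulr0 (C%:R : R)).
    by apply: cvgD; [exact: cvg_cst | apply: cvgMr; exact: cvg_harmonic].
  apply: squeeze_cvgr (cvg_cst _) cvgC; near=> d; rewrite /ncext_seq /=.
  have d0 : 0 < d.+1%:R :> R by rewrite ltr0n.
  have := @ext_gen_scale_bounds F Q alpha W M d.+1 (ex_intro2 _ _ W0 fW0 erefl) W0_max.
  rewrite -!(ler_int R) intrD intrM -/C -!pmulrn => /andP[ge le].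
  apply/andP; split; first by rewrite ler_pdivlMr // mulrC.
  by rewrite ler_pdivrMr // mulrDl mulfVK ?lt0r_neq0 // mulrC.
have ncextE : ncext R alpha W = M%:~R by apply: cvg_lim lim_M.
split; first by apply/cvg_ex; exists M%:~R.
split; first by exists W0.
by move=> _ [W'' fW ->]; rewrite ncextE ler_int; apply: W0_max.
Unshelve. all: by end_near.
Qed.
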